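(* Let $S$ and $T$ be finite monogenic semigroups. Then $S$ and $T$ are isomorphic if and only if their superextensions $\lambda(S)$ and $\lambda(T)$ are isomorphic semigroups.
   Context: A semigroup $S$ is monogenic if $S=\{a^n : n\in\mathbb N\}$ for some $a\in S$, where $\mathbb N=\{1,2,\dots\}$. Superextension: a family $\mathcal A$ of non-empty subsets of a set $X$ is an upfamily if $A\in\mathcal A$ and $A\subset B\subset X$ imply $B\in\mathcal A$. An upfamily $\mathcal L$ is linked if $A\cap B\neq\emptyset$ for all $A,B\in\mathcal L$; it is maximal linked if it is linked and coincides with each linked upfamily on $X$ that contains it. $\lambda(X)$ denotes the set of all maximal linked upfamilies on $X$. For a semigroup $S$, $\lambda(S)$ is a semigroup under the operation $$\mathcal A*\mathcal B=\Big\{C\subset S:\ \exists A\in\mathcal A\ \exists (B_a)_{a\in A}\in\mathcal B^{A}\ \text{ with } \bigcup_{a\in A}aB_a\subset C\Big\},\qquad aB=\{ab:b\in B\}.$$ *)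

(* Defs.v *)
From HB Require Import structures.
From mathcomp Require Import all_boot.

Set Implicit Arguments.
Unset Strict Implicit.
Unset Printing Implicit Defensive.

Local Open Scope group_scope.

#[short(type="finSemigroupType")]
HB.structure Definition FinSemigroup := {S of Semigroup S & Finite S}.

Bind Scope group_scope with FinSemigroup.sort.

(* The power a^n for n >= 1; a semigroup has no unit, and the value at n = 0
   is the junk value a. *)
Definition spow (S : semigroupType) (a : S) (n : nat) : S :=
  iterop n (@mul S) a a.

Definition monogenic (S : semigroupType) : Prop :=
  exists a : S, forall x : S, exists2 n : nat, 0 < n & x = spow a n.

Definition semigroup_isomorphic (S T : semigroupType) : Prop :=
  exists f : {multiplicative S -> T}, bijective f.

Section Families.
Variable X : finType.
Implicit Types (A B C : {set X}) (L M : {set {set X}}).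

Definition upfamily L : bool :=
  (set0 \notin L) && [forall A in L, forall B : {set X}, (A \subset B) ==> (B \in L)].

Definition linked L : bool :=
  [forall A in L, forall B in L, A :&: B != set0].

Definition maximal_linked L : bool :=
  maxset (fun M => upfamily M && linked M) L.

Lemma upfamilyP L :
  reflect (set0 \notin L /\ forall A B, A \in L -> A \subset B -> B \in L)
          (upfamily L).
Proof.
apply: (iffP andP) => -[L0 Lup]; split=> //.
  by move=> A B /(forall_inP Lup)/forallP/(_ B)/implyP.
by apply/forall_inP => A LA; apply/forallP => B; apply/implyP; apply: Lup.
Qed.

Lemma linkedP L :
  reflect (forall A B, A \in L -> B \in L -> A :&: B != set0) (linked L).
Proof.
apply: (iffP forall_inP) => [lL A B LA LB | lL A LA].
  exact: (forall_inP (lL A LA)).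
by apply/forall_inP => B; apply: lL.
Qed.

Lemma maximal_linkedP L :
  reflect [/\ upfamily L, linked L
            & forall M, upfamily M -> linked M -> L \subset M -> M = L]
          (maximal_linked L).
Proof.
apply: (iffP maxsetP) => [[/andP[uL lL] mL] | [uL lL mL]].
  by split=> // M uM lM; apply: mL; rewrite uM.
by split; [rewrite uL | move=> M /andP[]; apply: mL].
Qed.

Lemma maximal_linked_setT L (x : X) : maximal_linked L -> setT \in L.
Proof.
move=> /maximal_linkedP[/upfamilyP[L0 uL] /linkedP lL mL].
rewrite -(mL (setT |: L)) ?setU11 ?subsetUr //.
  apply/upfamilyP; split.
    rewrite !inE negb_or L0 andbT; apply/eqP => /setP/(_ x).
    by rewrite !inE.
  move=> A B; rewrite !inE => /orP[/eqP-> | LA] sAB.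
    by rewrite eqEsubset subsetT sAB.
  by rewrite (uL A B) ?orbT.
have nz A : A \in L -> A != set0 by apply: contraTneq => ->.
apply/linkedP => A B; rewrite !inE => /orP[/eqP-> | LA] /orP[/eqP-> | LB].
- by rewrite setTI; apply/set0Pn; exists x.
- by rewrite setTI nz.
- by rewrite setIT nz.
exact: lL.
Qed.

(* Over a nonempty X, a maximal linked upfamily contains exactly one of A and
   its complement. *)
Lemma maximal_linkedC L A (x : X) :
  maximal_linked L -> (~: A \in L) = (A \notin L).
Proof.
move=> mlL; have LT := maximal_linked_setT x mlL.
move/maximal_linkedP: mlL => [/upfamilyP[L0 uL] /linkedP lL mL].
apply/idP/idP => [LcA | nLA].
  by apply/negP => /lL/(_ LcA); rewrite setICr eqxx.
have cA0 : ~: A != set0.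
  by apply: contraNneq nLA => cA; rewrite -(setCK A) cA setC0.
have meet C : C \in L -> C :&: ~: A != set0.
  move=> LC; apply: contraNneq nLA => CcA.
  by apply: (uL C) => //; rewrite -(setCK A) -disjoints_subset -setI_eq0 CcA.
rewrite -(mL [set B | (B \in L) || (~: A \subset B)]) ?inE ?subxx ?orbT //.
- apply/upfamilyP; split=> [|B C]; rewrite !inE.
    by rewrite negb_or L0 subset0.
  by case/orP=> [LB /(uL _ _ LB)-> // | sB /(subset_trans sB)->]; rewrite orbT.
- have sub0 (D E : {set X}) : D \subset E -> D != set0 -> E != set0.
    by move=> sDE; apply: contraNneq => E0; rewrite -subset0 -E0.
  apply/linkedP => B C; rewrite !inE => /orP[LB | sB] /orP[LC | sC].
  + exact: lL.
  + by apply: sub0 (meet B LB); rewrite setIS.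
  + by apply: sub0 (meet C LC); rewrite setIC setSI.
  + by apply: sub0 cA0; rewrite subsetI sB.
by apply/subsetP => B; rewrite inE => ->.
Qed.

Lemma maximal_linkedI L :
  upfamily L -> linked L -> (forall A, (A \in L) || (~: A \in L)) ->
  maximal_linked L.
Proof.
move=> uL lL cL; apply/maximal_linkedP; split=> // M _ /linkedP lM sLM.
apply/eqP; rewrite eqEsubset sLM andbT; apply/subsetP => A MA.
case/orP: (cL A) => // /(subsetP sLM)/(lM _ _ MA).
by rewrite setICr eqxx.
Qed.

Record superextension := Superextension {
  mlfam :> {set {set X}};
  mlfamP : maximal_linked mlfam
}.

HB.instance Definition _ := [isSub for mlfam].
HB.instance Definition _ := [Finite of superextension by <:].

End Families.

Section Product.
Variable S : finSemigroupType.
Implicit Types (A B C : {set S}) (L M N : {set {set S}}).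

(* Values of B outside A are unconstrained, so quantifying over functions on
   all of S is quantifying over families indexed by A. *)
Definition family_mul L M : {set {set S}} :=
  [set C : {set S} | [exists A in L, exists B : {ffun S -> {set S}},
     [forall a in A, B a \in M] &&
     (\bigcup_(a in A) [set a * b | b in B a] \subset C)]].

Let mem_congr A B N : A = B -> (A \in N) = (B \in N).
Proof. by move->. Qed.

Lemma mem_family_mul L M C : upfamily L -> upfamily M ->
  (C \in family_mul L M) = ([set a | [set b | a * b \in C] \in M] \in L).
Proof.
move=> /upfamilyP[_ uL] /upfamilyP[_ uM]; rewrite inE; apply/idP/idP.
  case/exists_inP=> A LA /existsP[B /andP[/forall_inP MB /bigcupsP sBC]].
  apply: uL LA _; apply/subsetP => a Aa; rewrite inE.
  apply: uM (MB a Aa) _; apply/subsetP => b Bb; rewrite inE.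
  by apply: (subsetP (sBC a Aa)); apply: imset_f.
move=> LA; apply/exists_inP; eexists; first exact: LA.
apply/existsP; exists [ffun a => [set b | a * b \in C]].
apply/andP; split; first by apply/forall_inP => a; rewrite inE ffunE.
apply/bigcupsP => a _; apply/subsetP => _ /imsetP[b + ->].
by rewrite ffunE inE.
Qed.

Lemma maximal_linked_mul L M :
  maximal_linked L -> maximal_linked M -> maximal_linked (family_mul L M).
Proof.
move=> mL mM.
have [uL /linkedP lL _] := maximal_linkedP _ mL.
have [uM /linkedP lM _] := maximal_linkedP _ mM.
have [/upfamilyP[L0 upL] /upfamilyP[M0 upM]] := (uL, uM).
have memE (A B : {set S}) N : A = B -> A \in N -> B \in N by move=> ->.
have [x _ | S0] := pickP (@predT S); last first.
  suff -> : family_mul L M = L by [].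
  have e (N : {set {set S}}) : set0 \notin N -> N = set0.
    move=> N0; apply/setP => A; rewrite in_set0; apply: contraNF N0.
    by apply/memE/setP => y; have := S0 y.
  apply: etrans (e _ _) (esym (e _ L0)); rewrite mem_family_mul //.
  by apply: contraNN L0; apply/memE/setP => y; have := S0 y.
apply: maximal_linkedI.
- apply/upfamilyP; split=> [|A B]; rewrite !mem_family_mul //.
    apply: contraNN L0; apply/memE/setP => a; rewrite !inE.
    by apply: contraNF M0; apply/memE/setP => b; rewrite !inE.
  move=> LA sAB; apply: upL LA _; apply/subsetP => a; rewrite !inE => MA.
  by apply: upM MA _; apply/subsetP => b; rewrite !inE; apply: (subsetP sAB).
- apply/linkedP => A B; rewrite !mem_family_mul // => LA LB.
  have /set0Pn[a] := lL _ _ LA LB; rewrite !inE => /andP[MA MB].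
  have /set0Pn[b] := lM _ _ MA MB; rewrite !inE => ABab.
  by apply/set0Pn; exists (a * b); rewrite inE.
move=> A; rewrite !mem_family_mul // orbC -implyNb -(maximal_linkedC _ x) //.
apply/implyP; apply/memE/setP => a; rewrite !inE -(maximal_linkedC _ x) //.
by apply/mem_congr/setP => b; rewrite !inE negbK.
Qed.

Definition superextension_mul (L M : superextension S) : superextension S :=
  Superextension (maximal_linked_mul (mlfamP L) (mlfamP M)).

Lemma superextension_mulA : associative superextension_mul.
Proof.
have u (L : superextension S) : upfamily L.
  by have /maximal_linkedP[] := mlfamP L.
move=> L M N; apply: val_inj; apply/setP => C.
rewrite (mem_family_mul _ (u L) (u (superextension_mul M N))).
rewrite (mem_family_mul _ (u (superextension_mul L M)) (u N)).
rewrite (mem_family_mul _ (u L) (u M)); apply: mem_congr.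
apply/setP => a; rewrite [LHS]inE [RHS]inE (mem_family_mul _ (u M) (u N)).
apply/mem_congr/setP => b; rewrite !inE; apply: mem_congr.
by apply/setP => c; rewrite !inE mulgA.
Qed.

HB.instance Definition _ :=
  isSemigroup.Build (superextension S) superextension_mulA.

End Product.

(* Main.v *)
Require Import Defs.
From HB Require Import structures.
From mathcomp Require Import all_boot.

Set Implicit Arguments.
Unset Strict Implicit.
Unset Printing Implicit Defensive.

(** The isomorphism type of a finite monogenic semigroup S with generator a is
    determined by two numbers: its order n, and the index at which the
    sequence a, a^2, a^3, ... starts to repeat. The powers a, ..., a^n are
    distinct and exhaust S, so a^(n+1) = a^(r+1) for exactly one r < n, and the
    pair (n, r) is a presentation of S. Both numbers can be read off from the
    abstract semigroup lambda(S).

    - The order n: an injection X -> Y induces an injection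
      lambda(X) -> lambda(Y), which misses the principal ultrafilters at the
      points outside the image of X. Hence |lambda(X)| increases strictly with
      |X| ([card_superextension_lt]).

    - The number r: the descending chain of ideals S, S^2 = S * S, S^3, ...
      becomes stationary exactly at S^(r+1) ([stationary_presented]), and the
      chain of lambda(S) becomes stationary at the same place
      ([stationary_superextension]). On one side, every product of k elements
      of lambda(S) is supported by S^k, so the principal ultrafilter at an
      element of S^k that is not in S^(k+1) is a product of k elements of
      lambda(S), but not of k + 1 elements. On the other side, if the chain of
      S stops at S^k, then some power e of a satisfies x * e = x for all x in
      S^k; since the products of k elements of lambda(S) are supported by S^k,
      multiplying them on the right by the principal ultrafilter at e does not
      change them, so they are products of k + 1 elements.

    Conversely an isomorphism S -> T induces an isomorphism
    lambda(S) -> lambda(T), by functoriality of lambda. *)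

(** * The chain of powers of a semigroup *)

Section IdealPowers.
Local Open Scope group_scope.
Implicit Types S T : finSemigroupType.

(** This is S^(k+1), not S^k: the index is shifted so that k = 0 gives S. *)
Fixpoint ideal_power S (k : nat) : {set S} :=
  if k is k'.+1 then [set x * y | x in ideal_power S k', y in [set: S]]
  else [set: S].

Definition stationary S k := ideal_power S k \subset ideal_power S k.+1.

Lemma ideal_power_mul S k (x y : S) :
  x \in ideal_power S k -> x * y \in ideal_power S k.+1.
Proof. by move=> Sx; apply/imset2P; exists x y; rewrite ?inE. Qed.

Lemma imset_ideal_power S T (f : {multiplicative S -> T}) k :
  bijective f -> f @: ideal_power S k = ideal_power T k.
Proof.
case=> g fK gK; have surj y : exists x, y = f x by exists (g y).
elim: k => [|k IHk] /=.
  by apply/setP => y; have [x ->] := surj y; rewrite imset_f ?inE.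
apply/setP => z; apply/imsetP/imset2P => [[_ /imset2P[x y Sx _ ->] ->] | [u v]].
  by exists (f x) (f y); rewrite ?inE ?gmulfM // -IHk imset_f.
rewrite -IHk => /imsetP[x Sx ->] _ ->; have [y ->] := surj v.
by exists (x * y); rewrite ?gmulfM ?ideal_power_mul.
Qed.

Lemma stationary_isom S T k :
  semigroup_isomorphic S T -> stationary S k = stationary T k.
Proof.
case=> f bij_f; rewrite /stationary -!(imset_ideal_power _ bij_f).
apply/idP/idP => [|sST]; first exact: imsetS.
apply/subsetP => x Sx; rewrite -(mem_imset _ x (bij_inj bij_f)).
by rewrite (subsetP sST) ?imset_f.
Qed.

End IdealPowers.

(** * Presentations of finite monogenic semigroups *)

Section Powers.
Local Open Scope group_scope.
Variables (S : semigroupType) (a : S).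

Lemma spowM i j : spow a i.+1 * spow a j.+1 = spow a (i + j).+2.
Proof.
elim: i => // i IHi; rewrite addSn -[spow a i.+2]/(a * spow a i.+1).
by rewrite -mulgA IHi.
Qed.

(** If a^(j+1) = a^(i+1), the exponent k + 1 can be lowered by j - i as long as
    k >= j; repeating this ends at [wrap i j k], which is less than j. *)
Definition wrap (i j k : nat) := if k < i then k else i + (k - i) %% (j - i).

Lemma wrap_lt i j k : i < j -> wrap i j k < j.
Proof.
move=> lt_ij; rewrite /wrap; case: (ltnP k i) => [lt_ki | _].
  exact: ltn_trans lt_ki lt_ij.
by rewrite -ltn_subRL ltn_mod subn_gt0.
Qed.

Lemma wrap_ge i j k : minn i k <= wrap i j k.
Proof.
by rewrite /wrap; case: (ltnP k i) => _; rewrite ?leq_addr.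
Qed.

Lemma spow_period i j k : i < j -> spow a j.+1 = spow a i.+1 -> i <= k ->
  spow a (k + (j - i)).+1 = spow a k.+1.
Proof.
move=> lt_ij aij /subnKC <-; rewrite addnAC subnKC ?(ltnW lt_ij) //.
by case: (k - i) => [|s]; rewrite ?addn0 // !addnS -!spowM aij.
Qed.

Lemma spow_wrap i j k : i < j -> spow a j.+1 = spow a i.+1 ->
  spow a k.+1 = spow a (wrap i j k).+1.
Proof.
move=> lt_ij aij; rewrite /wrap; case: (ltnP k i) => // le_ik.
rewrite -{1}(subnKC le_ik) {1}(divn_eq (k - i) (j - i)) addnCA.
elim: (_ %/ _) => [|q IHq]; first by rewrite mul0n add0n.
rewrite mulSn -addnA addnC spow_period //.
exact: leq_trans (leq_addr _ _) (leq_addl _ _).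
Qed.

End Powers.

Section Presentations.
Local Open Scope group_scope.
Implicit Types S T : finSemigroupType.

(** For r < n, the element a presents S by the single relation
    a^(n+1) = a^(r+1). *)
Definition presented S (a : S) n r :=
  [/\ r < n,
      forall x : S, exists2 i, i < n & x = spow a i.+1,
      {in gtn n &, injective (fun i => spow a i.+1)}
    & spow a n.+1 = spow a r.+1].

(** A coincidence a^(j+1) = a^(i+1) with i < j leaves at most j powers of a, so
    it forces j >= n = |S|. Hence a, ..., a^n are distinct, they fill S by
    counting, and a^(n+1) is one of them. *)
Lemma monogenic_presented S :
  monogenic S -> exists (a : S) (r : nat), presented a #|S| r.
Proof.
case=> a gen_a; exists a; set n := #|S|.
have gen x : exists k, x = spow a k.+1.
  by have [[|k] // _ ->] := gen_a x; exists k.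
have no_repeat i j : i < j -> spow a j.+1 = spow a i.+1 -> n <= j.
  move=> lt_ij aij; rewrite -(card_ord j) /n -cardsT.
  apply: leq_trans (leq_imset_card (fun k : 'I_j => spow a k.+1) predT).
  apply/subset_leq_card/subsetP => x _; have [k ->] := gen x.
  rewrite (spow_wrap k lt_ij aij); apply/imsetP.
  by exists (Ordinal (wrap_lt k lt_ij)).
have inj_a : {in gtn n &, injective (fun i => spow a i.+1)}.
  move=> i j lt_in lt_jn aij; case: (ltngtP i j) => // [lt_ij | lt_ji].
    by have := no_repeat i j lt_ij (esym aij); rewrite leqNgt [j < n]lt_jn.
  by have := no_repeat j i lt_ji aij; rewrite leqNgt [i < n]lt_in.
have inj_ord : injective (fun i : 'I_n => spow a i.+1).
  by move=> i j /inj_a/val_inj-> //; apply: ltn_ord.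
have gen_lt x : exists2 i, i < n & x = spow a i.+1.
  have /codomP[i ->]: x \in codom (fun i : 'I_n => spow a i.+1).
    by apply: inj_card_onto; rewrite ?card_ord.
  by exists i.
by have [r lt_rn ar] := gen_lt (spow a n.+1); exists r.
Qed.

Section Stationary.
Variables (S : finSemigroupType) (a : S) (n r : nat).
Hypothesis pres_a : presented a n r.

Lemma ideal_powerP k x :
  reflect (exists2 i, k <= i & x = spow a i.+1) (x \in ideal_power S k).
Proof.
have [_ gen _ _] := pres_a.
apply: (iffP idP) => [|[i + ->]].
  elim: k x => [|k IHk] x /=; first by have [i _ ->] := gen x; exists i.
  case/imset2P=> y z /IHk[i le_ki ->] _ ->; have [j _ ->] := gen z.
  by exists (i + j).+1; rewrite ?spowM // ltnS (leq_trans le_ki) ?leq_addr.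
elim: k i => [|k IHk] [|i] // le_ki; rewrite ?inE //.
by rewrite -[i]addn0 -spowM ideal_power_mul ?IHk.
Qed.

(** If k < r, reducing an exponent greater than k + 1 by the defining relation
    never brings it down to k + 1, so a^(k+1) is not in S^(k+2). If r <= k, the
    element a^(i+1) with i >= k equals a^(i+1+(n-r)), whose exponent exceeds
    k + 1. *)
Lemma stationary_presented k : stationary S k = (r <= k).
Proof.
have [lt_rn gen inj_a an] := pres_a; apply/idP/idP => [sSk | le_rk].
  have: spow a k.+1 \in ideal_power S k.+1.
    by apply: (subsetP sSk); apply/ideal_powerP; exists k.
  case/ideal_powerP => i lt_ki; rewrite leqNgt => aki; apply/negP => lt_kr.
  have lt_kw : k < wrap r n i.
    by apply: leq_trans (wrap_ge r n i); rewrite leq_min lt_kr.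
  rewrite (spow_wrap i lt_rn an) in aki.
  have/inj_a ek: spow a k.+1 = spow a (wrap r n i).+1 by [].
  by rewrite -ek ?ltnn // in lt_kw; [apply: ltn_trans lt_rn | apply: wrap_lt].
apply/subsetP => x /ideal_powerP[i le_ki ->]; apply/ideal_powerP.
exists (i + (n - r)); last by rewrite spow_period // (leq_trans le_rk).
by rewrite -addn1 leq_add ?subn_gt0.
Qed.

(** The period n - r supplies the right identity a^(n-r) on the powers whose
    exponents exceed r. *)
Lemma stationary_right_id k :
  stationary S k -> exists e, {in ideal_power S k, forall x, x * e = x}.
Proof.
have [lt_rn _ _ an] := pres_a; rewrite stationary_presented => le_rk.
exists (spow a (n - r)) => _ /ideal_powerP[i le_ki ->].
have p_gt0 : 0 < n - r by rewrite subn_gt0.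
rewrite -{1}(prednK p_gt0) spowM -addnS prednK //.
by rewrite spow_period // (leq_trans le_rk).
Qed.

End Stationary.

Lemma presented_hom S T (a : S) (b : T) n r :
    presented a n r -> presented b n r ->
  exists f : {multiplicative S -> T}, forall i, f (spow a i.+1) = spow b i.+1.
Proof.
move=> [lt_rn gen_a inj_a an] [_ _ _ bn].
have [log lt_log logE] := fin_all_exists2 gen_a.
pose f x := spow b (log x).+1.
have fE i : f (spow a i.+1) = spow b i.+1.
  rewrite [RHS](spow_wrap i lt_rn bn) /f (_ : log _ = wrap r n i) //.
  apply: inj_a; rewrite -?logE; [exact: lt_log | exact: wrap_lt |].
  exact: spow_wrap.
have fM : {morph f : x y / x * y}.
  move=> x y; rewrite {1}(logE x) {1}(logE y) spowM fE -spowM.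
  by rewrite -!fE -!logE.
pose fmul := isMultiplicative.Build S T f fM.
pose F : {multiplicative S -> T} := HB.pack f fmul.
by exists F.
Qed.

Lemma presented_isom S T (a : S) (b : T) n r :
  presented a n r -> presented b n r -> semigroup_isomorphic S T.
Proof.
move=> pa pb; have [f fE] := presented_hom pa pb.
have [g gE] := presented_hom pb pa; have [_ gen_a _ _] := pa.
have [_ gen_b _ _] := pb; exists f; exists g => [x | y].
  by have [i _ ->] := gen_a x; rewrite fE gE.
by have [i _ ->] := gen_b y; rewrite gE fE.
Qed.

End Presentations.

(** * Functoriality of the superextension *)

Section Pushforward.
Implicit Types X Y : finType.

Lemma superextension_eqP X (L M : superextension X) :
  (forall A, (A \in mlfam L) = (A \in mlfam M)) -> L = M.
Proof. by move=> eqLM; apply/val_inj/setP. Qed.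

Lemma superextension_set0 X (L : superextension X) : set0 \notin mlfam L.
Proof. by have /maximal_linkedP[/upfamilyP[]] := mlfamP L. Qed.

(** The assumption that X has a point matters: on an empty X the empty family
    is maximal linked, but its image in a nonempty Y is not. *)
Lemma maximal_linked_push X Y (x0 : X) (f : X -> Y) (L : superextension X) :
  maximal_linked [set C : {set Y} | f @^-1: C \in mlfam L].
Proof.
have /maximal_linkedP[/upfamilyP[L0 uL] /linkedP lL _] := mlfamP L.
apply: maximal_linkedI => [||C].
- apply/upfamilyP; rewrite inE preimset0; split=> // A B.
  by rewrite !inE => LA sAB; apply: uL LA _; apply: preimsetS.
- apply/linkedP => A B; rewrite !inE => LA LB.
  have /set0Pn[x] := lL _ _ LA LB; rewrite -preimsetI inE => ABfx.
  by apply/set0Pn; exists (f x).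
by rewrite !inE preimsetC (maximal_linkedC _ x0 (mlfamP L)) orbN.
Qed.

Definition push X Y (x0 : X) (f : X -> Y) (L : superextension X) :=
  Superextension (maximal_linked_push x0 f L).

Lemma mem_push X Y (x0 : X) (f : X -> Y) L C :
  (C \in mlfam (push x0 f L)) = (f @^-1: C \in mlfam L).
Proof. by rewrite inE. Qed.

Lemma pushK X Y (x0 : X) (y0 : Y) (f : X -> Y) g :
  cancel f g -> cancel (push x0 f) (push y0 g).
Proof.
move=> fK L; apply: superextension_eqP => A; rewrite !mem_push.
by congr (_ \in mlfam _); apply/setP => x; rewrite !inE fK.
Qed.

Lemma maximal_linked_dirac X (x : X) :
  maximal_linked [set C : {set X} | x \in C].
Proof.
apply: maximal_linkedI => [||C]; last by rewrite !inE orbN.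
  apply/upfamilyP; rewrite !inE; split=> // A B.
  by rewrite !inE => Ax /subsetP->.
apply/linkedP => A B; rewrite !inE => Ax Bx.
by apply/set0Pn; exists x; rewrite inE Ax.
Qed.

Definition dirac X (x : X) := Superextension (maximal_linked_dirac x).

Lemma mem_dirac X (x : X) C : (C \in mlfam (dirac x)) = (x \in C).
Proof. by rewrite inE. Qed.

Lemma card_superextension_lt X Y (x0 : X) :
  #|X| < #|Y| -> #|{: superextension X}| < #|{: superextension Y}|.
Proof.
move=> ltXY.
pose f (x : X) : Y := enum_val (widen_ord (ltnW ltXY) (enum_rank x)).
have inj_f : injective f.
  by move=> x y /enum_val_inj/(congr1 val)/= /val_inj/enum_rank_inj.
have [y fy] : exists y, y \notin codom f.
  apply/existsP; rewrite -negb_forall; apply/negP => /forallP surj.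
  have := ltXY; rewrite ltnNge => /negP[]; rewrite -(card_codom inj_f).
  apply/subset_leq_card/subsetP => y _.
  exact: surj.
have inj_push : injective (push x0 f).
  move=> L M eqLM; apply: superextension_eqP => A.
  have <- : f @^-1: (f @: A) = A by apply/setP => x; rewrite !inE mem_imset.
  by rewrite -!(mem_push x0) eqLM.
rewrite -(card_codom inj_push); apply: proper_card.
apply/properP; split; first exact/subsetP.
(* The preimage of the member [set y] of dirac y is empty. *)
exists (dirac y) => //; apply/codomP => -[L eqL].
have: [set y] \in mlfam (push x0 f L) by rewrite -eqL mem_dirac inE.
suff -> : [set y] \in mlfam (push x0 f L) = false by [].
rewrite mem_push (_ : _ @^-1: _ = set0) ?(negbTE (superextension_set0 L)) //.
by apply/setP => x; rewrite !inE; apply: contraNF fy => /eqP <-; apply: codom_f.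
Qed.

End Pushforward.

(** * The semigroup of maximal linked upfamilies *)

Section Superextension.
Local Open Scope group_scope.
Implicit Types S T : finSemigroupType.

Lemma mem_superextension_mul S (L M : superextension S) C :
  (C \in mlfam (L * M)) =
    ([set x | [set y | x * y \in C] \in mlfam M] \in mlfam L).
Proof.
have [uL _ _] := maximal_linkedP _ (mlfamP L).
have [uM _ _] := maximal_linkedP _ (mlfamP M).
exact: mem_family_mul.
Qed.

Lemma diracM S (x y : S) : dirac (x * y) = dirac x * dirac y.
Proof.
apply: superextension_eqP => C.
by rewrite mem_superextension_mul !mem_dirac !inE.
Qed.

Lemma semigroup_isomorphic_superextension S T (x0 : S) :
  semigroup_isomorphic S T ->
  semigroup_isomorphic (superextension S) (superextension T).
Proof.
case=> f [g fK gK].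
have pushM : {morph push x0 f : L M / L * M}.
  move=> L M; apply: superextension_eqP => C.
  rewrite mem_push !mem_superextension_mul mem_push.
  congr (_ \in mlfam _); apply/setP => x; rewrite !inE.
  by congr (_ \in mlfam _); apply/setP => y; rewrite !inE gmulfM.
pose pmul := isMultiplicative.Build _ _ (push x0 f) pushM.
pose F : {multiplicative superextension S -> superextension T} :=
  HB.pack (push x0 f) pmul.
by exists F; exists (push (f x0) g); apply: pushK.
Qed.

Lemma dirac_ideal_power S k (x : S) :
  x \in ideal_power S k -> dirac x \in ideal_power (superextension S) k.
Proof.
elim: k x => [|k IHk] x /=; first by rewrite !inE.
by case/imset2P=> y z Sy _ ->; rewrite diracM ideal_power_mul ?IHk.
Qed.

(** A product of k + 1 maximal linked upfamilies is supported by S^(k+1). This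
    is stronger than having S^(k+1) as a member, because a maximal linked
    upfamily need not be closed under intersections. *)
Lemma ideal_power_supp S k (L : superextension S) (C D : {set S}) :
    L \in ideal_power (superextension S) k ->
    {in ideal_power S k, C =i D} ->
  (C \in mlfam L) = (D \in mlfam L).
Proof.
elim: k L C D => [|k IHk] L C D /=.
  move=> _ eqCD; congr (_ \in mlfam _); apply/setP => x.
  by rewrite eqCD ?inE.
case/imset2P=> M N SM _ -> eqCD; rewrite !mem_superextension_mul.
apply: IHk SM _ => x Sx; rewrite !inE; congr (_ \in mlfam _).
by apply/setP => y; rewrite !inE eqCD ?ideal_power_mul.
Qed.

Lemma stationary_superextension S k :
  monogenic S -> stationary (superextension S) k = stationary S k.
Proof.
move=> monS; have [a [r pa]] := monogenic_presented monS; apply/idP/idP.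
  move=> sLk; apply/subsetP => x /dirac_ideal_power/(subsetP sLk) SLx.
  have: [set x] \in mlfam (dirac x) by rewrite mem_dirac inE.
  apply: contraLR => nSx.
  rewrite (ideal_power_supp (D := set0) SLx) ?mem_dirac ?inE //.
  by move=> y Sy; rewrite !inE; apply: contraNF nSx => /eqP <-.
case/(stationary_right_id pa)=> e eK; apply/subsetP => L SL.
suff -> : L = L * dirac e by apply: ideal_power_mul.
apply: superextension_eqP => C; rewrite mem_superextension_mul.
by apply: ideal_power_supp SL _ => x Sx; rewrite !inE eK.
Qed.

End Superextension.

Theorem theorem3p2 (S T : finSemigroupType) (hS : monogenic S)
    (hT : monogenic T) :
  semigroup_isomorphic S T <->
  semigroup_isomorphic (superextension S) (superextension T).
Proof.
have [[a0 _] [b0 _]] := (hS, hT); split=> [|isoL].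
  exact: semigroup_isomorphic_superextension.
have [a [r pa]] := monogenic_presented hS.
have [b [s pb]] := monogenic_presented hT.
have cardL : #|{: superextension S}| = #|{: superextension T}|.
  by have [f bij_f] := isoL; apply: bij_eq_card bij_f.
have eqn : #|S| = #|T|.
  case: (ltngtP #|S| #|T|) => // [ltST | ltTS].
    by have := card_superextension_lt a0 ltST; rewrite cardL ltnn.
  by have := card_superextension_lt b0 ltTS; rewrite cardL ltnn.
have le_rs k : (r <= k) = (s <= k).
  rewrite -(stationary_presented pa) -(stationary_presented pb).
  rewrite -(stationary_superextension k hS) -(stationary_superextension k hT).
  exact: stationary_isom.
have eqr : r = s by apply/eqP; rewrite eqn_leq le_rs leqnn -le_rs leqnn.
by rewrite -eqn -eqr in pb; apply: presented_isom pa pb.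
Qed.
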